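(* (1) There exist transitive permutation groups on finite sets which are quasiprimitive but not pre-primitive, and there exist transitive permutation groups on finite sets which are pre-primitive but not quasiprimitive. (2) A transitive permutation group $G$ on a finite set $\Omega$ is primitive if and only if it is both quasiprimitive and pre-primitive.
   Context: A permutation group on $\Omega$ is a subgroup of the symmetric group $\mathrm{Sym}(\Omega)$. A partition of $\Omega$ is $G$-invariant if every $g\in G$ maps each part onto a part. The trivial partitions of $\Omega$ are the partition into singletons and the partition with a single part. The orbit partition of a subgroup $H\le G$ is the partition of $\Omega$ into $H$-orbits. Let $G$ be a transitive permutation group on a finite set $\Omega$. $G$ is primitive if every $G$-invariant partition is trivial. $G$ is quasiprimitive if every non-trivial normal subgroup of $G$ is transitive on $\Omega$. $G$ is pre-primitive if every $G$-invariant partition of $\Omega$ is the orbit partition of some subgroup of $G$. *)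

(* Defs.v *)
From mathcomp Require Import all_boot all_fingroup all_solvable.

Set Implicit Arguments.
Unset Strict Implicit.
Unset Printing Implicit Defensive.

Local Open Scope group_scope.

Definition invariant_partition (T : finType) (G : {group {perm T}})
    (P : {set {set T}}) : bool :=
  partition P [set: T] && [acts G, on P | 'P^*].

Definition orbit_partition (T : finType) (H : {group {perm T}}) :
    {set {set T}} :=
  orbit 'P H @: [set: T].

Definition quasiprimitive (T : finType) (G : {group {perm T}}) : Prop :=
  forall N : {group {perm T}},
    N <| G -> N :!=: 1 -> [transitive N, on [set: T] | 'P].

Definition preprimitive (T : finType) (G : {group {perm T}}) : Prop :=
  forall P : {set {set T}}, invariant_partition G P ->
    exists2 H : {group {perm T}}, H \subset G & P = orbit_partition H.

(* MathComp's [primitive _, on _ | _] includes transitivity and measures the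
   triviality of a partition by its number of parts; for a transitive group it
   says that the only invariant partitions are the one into singletons and the
   one with a single part. *)
Lemma primitiveP (T : finType) (G : {group {perm T}}) :
  [transitive G, on [set: T] | 'P] ->
  reflect (forall P : {set {set T}}, invariant_partition G P ->
             P = [set [set x] | x in T] \/ P = [set [set: T]])
          [primitive G, on [set: T] | 'P].
Proof.
move=> trG; rewrite /primitive trG /=.
have c1 : #|[set [set x] | x in T]| = #|T|.
  by rewrite card_imset //; apply: set1_inj.
apply: (iffP idP) => [|H].
  have [x0 _ _] := imsetP trG.
  rewrite negb_exists => /forallP H P /andP[pP aP].
  have /and3P[/eqP cP tP n0] := pP.
  move: (H P); rewrite /imprimitivity_system pP aP /= negb_and -!leqNgt cardsT.
  have inP x : pblock P x \in P by rewrite pblock_mem // cP.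
  case/orP=> [le1|geT]; [right|left].
    have /cards1P[B PB] : #|P| == 1%N.
      by rewrite eqn_leq le1; apply/card_gt0P; exists (pblock P x0).
    by rewrite PB; congr [set _]; rewrite -cP PB /cover big_set1.
  have gt0 B : B \in P -> 0 < #|B|.
    by move=> BP; rewrite card_gt0; apply: contraNneq n0 => <-.
  have sP : (\sum_(B in P) #|B| <= #|P|)%N.
    by rewrite -(card_partition pP) cardsT.
  have B1 B : B \in P -> #|B| = 1%N.
    move=> BP; apply/eqP; rewrite eqn_leq gt0 // andbT.
    move: sP; rewrite -sum1_card (bigD1 B) //= [X in _ <= X](bigD1 B) //=.
    move=> le; rewrite -(leq_add2r (\sum_(i in P | i != B) 1)).
    apply: leq_trans le; rewrite leq_add2l; apply: leq_sum => C /andP[CP _].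
    exact: gt0.
  apply/eqP; rewrite eqEcard c1 geT andbT; apply/subsetP => B BP.
  have /eqP/cards1P[x ->] := B1 B BP; exact: imset_f.
apply/existsPn => P; apply/negP => /and3P[pP aP].
have [|->|->] := H P; first by rewrite /invariant_partition pP.
  by rewrite c1 cardsT ltnn andbF.
by rewrite cards1.
Qed.

(* Main.v *)
Require Import Defs.
From mathcomp Require Import all_boot all_fingroup all_solvable.
From mathcomp Require Import zmodp.

Set Implicit Arguments.
Unset Strict Implicit.
Unset Printing Implicit Defensive.

Local Open Scope group_scope.

(** The easy half of the equivalence: a primitive group has only the two
    trivial invariant partitions, which are the orbit partitions of 1 and of G
    (so G is pre-primitive); and the orbits of a normal subgroup form an
    invariant partition, so that the subgroup is trivial or transitive (and G
    is quasiprimitive).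

    For the converse, let P be an invariant partition, written by
    pre-primitivity as the set of orbits of some H <= G.  The kernel N of the
    action of G on the parts of P is normal in G, and it contains H since H
    fixes each of its own orbits.  By quasiprimitivity N is trivial or
    transitive.  If N = 1, then H = 1 and the parts of P are singletons; if N is
    transitive, then a part of P, being fixed by N, is everything.

    Both separating examples are regular representations.  In a regular group
    of composite order the trivial point stabiliser is not maximal, so the
    group is imprimitive; by the equivalence it cannot be both quasiprimitive
    and pre-primitive, and it suffices to see that it is one of them.
    A simple group is quasiprimitive as soon as it is transitive, which gives
    the regular representation of the alternating group of degree 5; an abelian
    transitive group is always pre-primitive, which gives the regular
    representation of the cyclic group of order 4. *)

(** * Primitivity, quasiprimitivity and pre-primitivity *)

Section TransitiveGroups.

Variables (T : finType) (G : {group {perm T}}).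
Hypothesis trG : [transitive G, on [set: T] | 'P].

Lemma orbit_partition1 :
  Defs.orbit_partition (1%G : {group {perm T}}) = [set [set x] | x in T].
Proof.
have orb1 x : orbit 'P 1 x = [set x] by apply/orbit1P; rewrite afix1 inE.
by apply/setP=> B; apply/imsetP/imsetP=> -[x _ ->]; exists x; rewrite ?orb1.
Qed.

Lemma orbit_partition_transitive : Defs.orbit_partition G = [set [set: T]].
Proof.
have [x0 _ _] := imsetP trG.
apply/setP=> B; rewrite inE; apply/imsetP/eqP => [[x _ ->]|->].
  exact: (atransP trG).
by exists x0 => //; rewrite (atransP trG).
Qed.

Lemma primitive_quasiprimitive :
  [primitive G, on [set: T] | 'P] -> quasiprimitive G.
Proof.
move=> primG N nNG ntN; case: (prim_trans_norm primG nNG) => // sN.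
case/negP: ntN; apply/eqP/trivgP; apply: subset_trans sN _.
exact: aperm_faithful.
Qed.

Lemma primitive_preprimitive :
  [primitive G, on [set: T] | 'P] -> preprimitive G.
Proof.
move/(primitiveP trG)=> primG P /primG[]->.
  by exists 1%G; rewrite ?sub1G ?orbit_partition1.
by exists G; rewrite ?orbit_partition_transitive.
Qed.

(** The kernel of the action on the parts, rather than the subgroup that
    realises them as orbits, is what quasiprimitivity applies to: the latter
    need not be normal. *)
Definition part_kernel (P : {set {set T}}) : {group {perm T}} :=
  'C_G(P | 'P^*)%G.

Lemma part_kernel_normal (P : {set {set T}}) :
  invariant_partition G P -> part_kernel P <| G.
Proof.
case/andP=> _ actsP; rewrite /normal subsetIl normsI ?normG //.
by apply: subset_trans actsP _; apply: normal_norm (astab_normal _ _).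
Qed.

Lemma part_kernel_fix (P : {set {set T}}) B n :
  B \in P -> n \in part_kernel P -> n \in 'N(B | 'P).
Proof.
move=> BP /setIP[_ /astabP fixP]; rewrite -astab1_set.
by apply/astab1P; apply: fixP.
Qed.

Lemma orbits_sub_part_kernel (H : {group {perm T}}) :
  H \subset G -> H \subset part_kernel (Defs.orbit_partition H).
Proof.
move=> sHG; rewrite subsetI sHG; apply/subsetP=> h hH.
apply/astabP=> _ /imsetP[x _ ->].
apply/astab1P; rewrite astab1_set.
exact: (subsetP (acts_orbit 'P x (subsetT H))).
Qed.

Lemma quasi_preprimitive_primitive :
  quasiprimitive G -> preprimitive G -> [primitive G, on [set: T] | 'P].
Proof.
move=> qG pG; apply/(primitiveP trG) => P invP.
have [H sHG defP] := pG P invP.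
have sHN : H \subset part_kernel P.
  by rewrite defP; apply: orbits_sub_part_kernel.
have [N1|ntN] := eqVneq (part_kernel P : {set _}) 1.
  left; rewrite defP -orbit_partition1; congr Defs.orbit_partition.
  by apply/val_inj/trivgP; rewrite /= -N1.
right; have trN := qG _ (part_kernel_normal invP) ntN.
have full B : B \in P -> B = setT.
  move=> BP; have [x _ defB] : exists2 x, x \in setT & B = orbit 'P H x.
    by apply/imsetP; move: BP; rewrite defP.
  have xB : x \in B by rewrite defB orbit_refl.
  apply/setP=> y; rewrite inE.
  have [n nN ->] := atransP2 trN (in_setT x) (in_setT y).
  by rewrite (astabs_act _ (part_kernel_fix BP nN)).
have [x0 _ _] := imsetP trG.
have orbP : orbit 'P H x0 \in P by rewrite defP imset_f.
apply/setP=> B; rewrite inE; apply/idP/eqP => [/full //|->].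
by rewrite -(full _ orbP).
Qed.

Lemma pblock_act (P : {set {set T}}) x g :
  invariant_partition G P -> g \in G ->
  pblock P (g x) = ('P^*)%act (pblock P x) g.
Proof.
case/andP=> /and3P[/eqP covP tiP _] actsP gG.
apply: def_pblock => //; last first.
  by apply: (imset_f (aperm^~ g)); rewrite mem_pblock covP.
by rewrite (acts_act actsP) // pblock_mem // covP.
Qed.

(** An abelian group acts on the parts through a regular quotient, so an element
    that maps some part to itself belongs to the kernel of the action on the
    parts.  Hence the kernel is transitive on each part. *)
Lemma abelian_preprimitive : abelian G -> preprimitive G.
Proof.
move=> abG P invP; have /andP[/and3P[/eqP covP tiP n0] _] := invP.
exists (part_kernel P); first exact: subsetIl.
have part_orbit x : orbit 'P (part_kernel P) x = pblock P x.
  have xP : pblock P x \in P by rewrite pblock_mem // covP.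
  have xx : x \in pblock P x by rewrite mem_pblock covP.
  apply/setP=> y; apply/orbitP/idP => [[n nN <-]|yx].
    by rewrite (astabs_act _ (part_kernel_fix xP nN)).
  have [g gG def_y] := atransP2 trG (in_setT x) (in_setT y).
  (* A part C is the translate by some k of the part of x, which g fixes. *)
  exists g => //; rewrite inE gG; apply/astabP=> C CP.
  have /set0Pn[z zC] : C != set0 by apply: contraNneq n0 => <-.
  have [k kG def_z] := atransP2 trG (in_setT x) (in_setT z).
  rewrite -(def_pblock tiP CP zC) -pblock_act // def_z /=.
  have -> : g (aperm x k) = k (g x).
    by rewrite /aperm -!permM (centsP abG k kG g gG).
  rewrite !pblock_act //; congr (_ _ _).
  by rewrite -pblock_act // (_ : g x = y) // (def_pblock tiP xP yx).
apply/setP=> B; apply/idP/imsetP => [BP|[x _ ->]].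
  have /set0Pn[x xB] : B != set0 by apply: contraNneq n0 => <-.
  by exists x; rewrite // part_orbit (def_pblock tiP BP xB).
by rewrite part_orbit pblock_mem // covP.
Qed.

Lemma simple_quasiprimitive : simple G -> quasiprimitive G.
Proof.
by case/simpleP=> _ simG N nNG ntN; case: (simG N nNG) ntN => ->; rewrite ?eqxx.
Qed.

(** A transitive group whose order is its degree has trivial point stabilisers.
    Primitivity makes 1 a maximal subgroup, so that a subgroup of prime order,
    which exists by Cauchy's theorem, is the whole group. *)
Lemma regular_primitive_prime :
  #|G| = #|T| -> 1 < #|G| -> [primitive G, on [set: T] | 'P] -> prime #|G|.
Proof.
have [x0 _ _] := imsetP trG.
move=> oG ntG; rewrite (trans_prim_astab (in_setT x0) trG) => maxS.
have S1 : 'C_G[x0 | 'P] = 1.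
  apply/eqP; rewrite trivg_card1; apply/eqP.
  have := card_orbit_stab 'P G x0; rewrite (atransP trG) // cardsT oG.
  rewrite -[RHS]muln1 => /eqP.
  by rewrite eqn_pmul2l -?oG ?cardG_gt0 // => /eqP.
move: maxS; rewrite S1 => /maximal_eqP[_ maxG].
have pr_p := pdiv_prime ntG.
have [x Gx ox] := Cauchy pr_p (pdiv_dvd #|G|).
have sxG : <[x]> \subset G by rewrite cycle_subG.
case: (maxG <[x]>%G (sub1G _) sxG) => /= defx.
  by move: pr_p; rewrite -ox orderE defx cards1.
by rewrite -defx -orderE ox.
Qed.

End TransitiveGroups.

(** * Regular representations *)

Section RegularRepresentation.

Variable gT : finGroupType.

Definition regular_group : {group {perm gT}} :=
  (actperm 'R @* [set: gT])%G.

Lemma regular_group_isog : [set: gT] \isog regular_group.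
Proof.
apply: sub_isog => //.
by rewrite ker_actperm astabR.
Qed.

Lemma regular_group_transitive : [transitive regular_group, on [set: gT] | 'P].
Proof.
apply/imsetP; exists 1 => //; rewrite orbit_morphim_actperm //.
by rewrite (atransP (atransR [set: gT])).
Qed.

Lemma regular_group_imprimitive :
  1 < #|gT| -> ~~ prime #|gT| ->
  ~~ [primitive regular_group, on [set: gT] | 'P].
Proof.
move=> gt1; apply: contra.
have oG : #|regular_group| = #|gT|.
  by rewrite -(card_isog regular_group_isog) cardsT.
rewrite -[X in prime X]oG; apply: regular_primitive_prime => //.
  exact: regular_group_transitive.
by rewrite oG.
Qed.

End RegularRepresentation.

Theorem theorem1p2 :
  [/\ (exists (T : finType) (G : {group {perm T}}),
         [/\ [transitive G, on [set: T] | 'P],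
             quasiprimitive G
           & ~ preprimitive G]),
      (exists (T : finType) (G : {group {perm T}}),
         [/\ [transitive G, on [set: T] | 'P],
             preprimitive G
           & ~ quasiprimitive G])
    & forall (T : finType) (G : {group {perm T}}),
        [transitive G, on [set: T] | 'P] ->
        ([primitive G, on [set: T] | 'P] <->
           quasiprimitive G /\ preprimitive G)].
Proof.
split; last 1 first.
- move=> T G trG; split=> [primG | [qG pG]].
    by split; [apply: primitive_quasiprimitive | apply: primitive_preprimitive].
  exact: quasi_preprimitive_primitive.
- pose gT := subg_of 'Alt_('I_5)%G.
  have isoA : 'Alt_('I_5) \isog [set: gT] := isog_subg _.
  have oA : #|gT| = 60.
    rewrite -cardsT -(card_isog isoA).
    by apply/eqP; rewrite -(eqn_pmul2l (isT : 0 < 2)) card_Alt card_ord.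
  have trA := regular_group_transitive gT.
  have qA : quasiprimitive (regular_group gT).
    apply: (simple_quasiprimitive trA).
    rewrite -(isog_simple (regular_group_isog gT)) -(isog_simple isoA).
    by rewrite simple_Alt5 ?card_ord.
  exists gT, (regular_group gT); split=> // pA.
  suff /negP[] : ~~ [primitive (regular_group gT), on [set: gT] | 'P].
    exact: quasi_preprimitive_primitive.
  by apply: regular_group_imprimitive; rewrite oA.
have trZ := regular_group_transitive 'Z_4.
have pZ : preprimitive (regular_group 'Z_4).
  apply: (abelian_preprimitive trZ); apply: morphim_abelian.
  exact: Zp_abelian.
exists 'Z_4, (regular_group 'Z_4); split=> // qZ.
suff /negP[] : ~~ [primitive (regular_group 'Z_4), on [set: 'Z_4] | 'P].
  exact: quasi_preprimitive_primitive.
by apply: regular_group_imprimitive; rewrite card_ord.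
Qed.
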